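(* Let $p$ be a prime, $r\ge 1$, $q=p^r$, and $m$ a positive integer divisible by $r$. Suppose that $p>3$ or $m>2$ or $r\neq 1$. Let $d_A$ be the minimum distance of an extended maximal affine-invariant code of length $p^m$ over $\mathbb{F}_q$. Then there exists a quantum code with parameters $$\Big[\Big[p^m,\ p^m-2-2\tfrac{m}{r},\ d_Q\Big]\Big]_q \quad\text{with}\quad \tfrac{m}{r}+2\ \ge\ d_Q\ \ge\ d_A .$$
   Context: Classical codes. Let $n=p^m-1$ and let $\beta$ be a fixed primitive $n$-th root of unity in $G=\mathbb{F}_{p^m}$. A cyclic code $C$ of length $n$ over $\mathbb{F}_q$ is an ideal of $\mathbb{F}_q[x]/(x^n-1)$ generated by a polynomial $g(x)$ dividing $x^n-1$; its defining set is $T=\{0\le i\le n-1 : g(\beta^i)=0\}$, a union of cyclotomic classes $Cl(j)=\{jq^l \bmod n : l\in\mathbb{Z}\}$. $C$ is a maximal cyclic code if $T$ consists of exactly one cyclotomic class. The extended code of $C$ is $\hat{C}=\{(x_0,x_1,\dots,x_n) : (x_1,\dots,x_n)\in C,\ x_0=-\sum_{i=1}^n x_i\}$, of length $p^m$, with coordinates labelled by the elements of $G$: $x_0$ is labelled by $0$, and the coordinate of $C$ that is the coefficient of $x^i$ is labelled by $\beta^i$. $\hat{C}$ is affine-invariant if it is invariant under all coordinate permutations induced by the maps $X\mapsto aX+b$ of $G$, $a\in G\setminus\{0\}$, $b\in G$. An extended maximal affine-invariant code is an affine-invariant code of the form $\hat{C}$ with $C$ a maximal cyclic code. Quantum codes.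 Let $\{|x\rangle : x\in\mathbb{F}_q\}$ be an orthonormal basis of $\mathbb{C}^q$, let $\ell$ be the characteristic of $\mathbb{F}_q$, and $\omega=e^{2\pi i/\ell}$. For $a,b\in\mathbb{F}_q^N$ let $E_{a,b}$ be the operator on $(\mathbb{C}^q)^{\otimes N}$ equal to $\bigotimes_i X(a_i)Z(b_i)$, where $X(a)|x\rangle=|x+a\rangle$ and $Z(b)|x\rangle=\omega^{\mathrm{tr}(bx)}|x\rangle$ with $\mathrm{tr}:\mathbb{F}_q\to\mathbb{F}_\ell$ the trace; its weight is the number of $i$ with $(a_i,b_i)\ne(0,0)$. A quantum code with parameters $[[N,K,d]]_q$ is a subspace of $(\mathbb{C}^q)^{\otimes N}$ of dimension $q^K$, with orthogonal projector $P$, such that $d$ is the largest integer for which every $E_{a,b}$ of weight less than $d$ satisfies $PE_{a,b}P=cP$ for some scalar $c$ (depending on $a,b$). For $K=0$ the usual convention is to require instead that $d$ be the largest integer such that $PE_{a,b}P=0$ for all $E_{a,b}$ of weight between $1$ and $d-1$. *)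

(* Defs.v *)
From HB Require Import structures.
From mathcomp Require Import all_boot all_order all_algebra all_fingroup all_field.
From mathcomp Require Import all_classical all_reals all_analysis.
From mathcomp Require Import complex.

Set Implicit Arguments.
Unset Strict Implicit.
Unset Printing Implicit Defensive.

Import Order.TTheory GRing.Theory Num.Theory.

Local Open Scope ring_scope.
Local Open Scope complex_scope.

Section ClassicalCodes.

Variables (F G : finFieldType) (emb : {rmorphism F -> G}).

(* For n > 0 the polynomial 'X^n - 1 is monic of positive degree, so that *)
(* {poly %/ 'X^n - 1} is indeed F[x]/(x^n - 1). *)
Definition cyclic_code (n : nat) (g : {poly F}) :
    {set {poly %/ ('X^n - 1 : {poly F})}} :=
  [set h * in_qpoly ('X^n - 1) g | h : {poly %/ ('X^n - 1 : {poly F})}].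

Definition defining_set (n : nat) (beta : G) (g : {poly F}) : {set 'I_n} :=
  [set i : 'I_n | root (map_poly emb g) (beta ^+ i)].

(* i = j q^l mod n for some l in Z, where q = #|F|; q is a unit mod n in all *)
(* uses, and i = j q^(-l) is expressed as i q^l = j. *)
Definition cyclotomic_class (n j i : nat) : Prop :=
  exists l : nat, i = j * #|F| ^ l %[mod n] \/ i * #|F| ^ l = j %[mod n].

Definition maximal_cyclic (n : nat) (beta : G) (g : {poly F}) : Prop :=
  exists j : 'I_n, forall i : 'I_n,
    i \in defining_set n beta g <-> cyclotomic_class n j i.

(* Words of the extended code are functions on the set G of labels. *)
Definition extended_code (n : nat) (beta : G) (g : {poly F}) :
    {set {ffun G -> F}} :=
  [set x : {ffun G -> F} |
    [exists c in cyclic_code n g,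
       [forall i : 'I_n, x (beta ^+ i) == (c : {poly F})`_i]]
    && (x 0 == - \sum_(i < n) x (beta ^+ i))].

Definition affine_invariant (D : {set {ffun G -> F}}) : Prop :=
  forall a b : G, a != 0 ->
    [set [ffun X => x (a * X + b)] | x : {ffun G -> F} in D] = D.

Definition hamming_dist (x y : {ffun G -> F}) : nat :=
  #|[set X | x X != y X]|.

Definition minimum_distance (D : {set {ffun G -> F}}) (d : nat) : Prop :=
  (exists x y, [/\ x \in D, y \in D, x != y & hamming_dist x y = d]) /\
  (forall x y, x \in D -> y \in D -> x != y -> (d <= hamming_dist x y)%N).

End ClassicalCodes.

(* The complex space with orthonormal basis |x>, x in T. *)
Notation hilb R T := {ffun T -> ((complex R)^o)%type} (only parsing).

(* (C^q)^(tensor N), with orthonormal basis |x_1> ... |x_N>, x in F^N. *)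
Notation nqudits R F N := (hilb R 'rV[F]_N) (only parsing).

Section QuantumCodes.

Variables (R : realType) (F : finFieldType).

(* The characteristic: #|F| is a power of it. *)
Definition fchar : nat := pdiv #|F|.

(* The absolute trace x + x^l + ... + x^(l^(r-1)), #|F| = l^r, is computed in *)
(* the prime subfield of F and then read in 'F_l. *)
Definition abs_trace (x : F) : 'F_fchar :=
  odflt 0 [pick z : 'F_fchar |
    (z : nat)%:R == \sum_(i < logn fchar #|F|) x ^+ (fchar ^ i)].

Definition omega : R[i] :=
  cos (2%:R * pi / fchar%:R) +i* sin (2%:R * pi / fchar%:R).

Definition ket (T : finType) (x : T) : hilb R T := [ffun y => (y == x)%:R].

Definition inner (T : finType) (f g : hilb R T) : R[i] :=
  \sum_(x : T) f x * (g x)^*.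

(* The operator mapping |x> to A x. *)
Definition op_of_kets (T : finType) (A : T -> hilb R T) : 'End(hilb R T) :=
  linfun (fun f : hilb R T => \sum_(x : T) f x *: A x).

Definition pauliX (a : F) : 'End(hilb R F) :=
  op_of_kets (fun x => ket (x + a)).

Definition pauliZ (b : F) : 'End(hilb R F) :=
  op_of_kets (fun x => omega ^+ abs_trace (b * x) *: ket x).

Definition tensor_vec (N : nat) (v : 'I_N -> hilb R F) : nqudits R F N :=
  [ffun y : 'rV[F]_N => \prod_(i < N) v i (y 0 i)].

Definition tensor_op (N : nat) (A : 'I_N -> 'End(hilb R F)) :
    'End(nqudits R F N) :=
  op_of_kets (fun x : 'rV[F]_N => tensor_vec (fun i => A i (ket (x 0 i)))).

Definition pauliE (N : nat) (a b : 'rV[F]_N) : 'End(nqudits R F N) :=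
  tensor_op (fun i => (pauliX (a 0 i) \o pauliZ (b 0 i))%VF).

Definition weight (N : nat) (a b : 'rV[F]_N) : nat :=
  #|[set i : 'I_N | (a 0 i, b 0 i) != (0, 0)]|.

Definition orthogonal_projector (N : nat) (U : {vspace nqudits R F N})
    (P : 'End(nqudits R F N)) : Prop :=
  forall f : nqudits R F N,
    P f \in U /\ (forall u : nqudits R F N, u \in U -> inner (f - P f) u = 0).

(* For K = 0 the requirement P E P = c P is void, P having rank one; the usual *)
(* convention then asks for P E P = 0 on weights 1, ..., d - 1. *)
Definition detects_below (N K : nat) (P : 'End(nqudits R F N))
    (d : nat) : Prop :=
  forall a b : 'rV[F]_N, (weight a b < d)%N ->
    if K == 0%N then
      (0 < weight a b)%N -> (P \o pauliE a b \o P)%VF = 0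
    else exists c : R[i], (P \o pauliE a b \o P)%VF = c *: P.

Definition quantum_code (N K d : nat) (U : {vspace nqudits R F N}) : Prop :=
  \dim U = (#|F| ^ K)%N /\
  exists P : 'End(nqudits R F N),
    [/\ orthogonal_projector U P,
        detects_below K P d
      & forall d' : nat, detects_below K P d' -> (d' <= d)%N].

End QuantumCodes.

(* Main.v *)
(* Affine invariance forces the defining set to be the cyclotomic class of a  *)
(* power p^v of p: if j = p^v u belongs to it, the syndrome of degree j of    *)
(* all translates of a word vanishes, and in (X^(p^v) + b)^u the coefficient  *)
(* of b^(u-1) is u X^(p^v). In coordinates of G over F, and up to the         *)
(* bijection X |-> X^(p^v), the extended code is therefore the kernel of the  *)
(* matrix H whose rows are the functions 1, c_1, ..., c_s on F^s, s = m/r.    *)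
(* Products of two rows are monomials of degree at most 2 < s(q-1), which sum *)
(* to 0 over F^s, so H H^T = 0 and H yields a CSS code, spanned by the        *)
(* uniform superpositions over the cosets of the row space of H in its        *)
(* kernel. It detects all errors of weight less than d_A. Conversely the      *)
(* kernel of H is generated by words of weight at most s + 2; if the phase    *)
(* errors given by these words were all detected, they would lie in the row   *)
(* space of H, which is impossible for dimension reasons if K > 0, while for  *)
(* K = 0 each of them fixes the code.                                         *)

Require Import Defs.
From HB Require Import structures.
From mathcomp Require Import all_boot all_order all_algebra all_fingroup all_field.
From mathcomp Require Import all_classical all_reals all_analysis.
From mathcomp Require Import complex.

Set Implicit Arguments.
Unset Strict Implicit.
Unset Printing Implicit Defensive.

Import Order.TTheory GRing.Theory Num.Theory.
Local Open Scope ring_scope.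

(** * Additive characters of a finite field *)

(** The quantum code is the CSS code of a self-orthogonal matrix [H] of rank k = s + 1, with s =
    m/r. Projecting, applying [pauliE a b] and projecting again produces a character sum over the
    row space of [H] ([css_sandwichE]). The result is zero unless [a] and [b] both lie in the kernel
    of [H], so the distance is at least the least nonzero weight of the kernel; for [a = 0] and [b]
    in the kernel only the phase of [b] remains, which caps the distance at k + 1 ([css_code]). On
    the classical side, [extended_code_power_sum] reduces membership to two equations, the
    coordinate sum and one power sum of exponent p^v. In a basis of G over F ([field_basis]) they
    follow from the k equations given by the rows of [H] ([affine_mx]), so the kernel of [H] lies in
    the extended code and its nonzero words have weight at least d_A. The condition on p, m and r
    ensures s(q-1) > 2 ([degree_bound]), hence self-orthogonality ([affine_mx_self_orthogonal]). *)

Section AdditiveCharacter.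

Variables (R : realType) (F : finFieldType).

Local Notation p := (fchar F).

Lemma fchar_prime : prime p.
Proof. by rewrite /fchar pdiv_prime // finNzRing_gt1. Qed.

Lemma omegaX k : omega R F ^+ k =
  (cos (2%:R * pi / p%:R *+ k) +i* sin (2%:R * pi / p%:R *+ k))%C.
Proof.
elim: k => [|k IHk]; first by rewrite expr0 mulr0n cos0 sin0.
rewrite exprS IHk (mulrS (2%:R * pi / p%:R)) cosD sinD /omega.
by apply/eqP; rewrite eq_complex /= eqxx /= addrC.
Qed.

Lemma omega_fchar : omega R F ^+ p = 1.
Proof.
have p0 : (p%:R : R) != 0 by rewrite pnatr_eq0 -lt0n prime_gt0 ?fchar_prime.
rewrite omegaX -mulr_natr divfK // mulr_natl cos2pi.
by rewrite -[X in sin X]add0r sinD2pi sin0.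
Qed.

(** The half angle is used because sin (2 pi/p) vanishes for p = 2: real part 1 would force cos^2
    (pi/p) = 1, against sin (pi/p) > 0. *)
Lemma omega_neq1 : omega R F != 1.
Proof.
have p0 : 0 < (p%:R : R) by rewrite ltr0n prime_gt0 ?fchar_prime.
have s0 : 0 < sin (pi / p%:R :> R).
  apply: sin_gt0_pi; rewrite divr_gt0 ?pi_gt0 //= ltr_pdivrMr // ltr_pMr ?pi_gt0 //.
  by rewrite ltr1n prime_gt1 ?fchar_prime.
apply/negP => /eqP/(congr1 (@complex.Re R)) /=.
rewrite -mulrA mulr_natl cos_mulr2n => /(canRL (subrK _)) c1.
have := cos2Dsin2 (pi / p%:R :> R).
have -> : cos (pi / p%:R :> R) ^+ 2 = 1.
  by apply: (@mulIf _ 2%:R); rewrite ?pnatr_eq0 // mulr_natr c1 mul1r.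
move=> /(canRL (addKr _)); rewrite addNr => /eqP.
by rewrite expf_eq0 /= gt_eqF.
Qed.

Lemma fchar_pchar : p \in [pchar F].
Proof.
have [l l_pr lF] := finPcharP F.
have := finNzRing_gt1 F; rewrite /fchar (card_pprimeChar lF).
by case: (logn _ _) => // n _; rewrite pdiv_pfactor.
Qed.

Lemma card_fchar : #|F| = (p ^ logn p #|F|)%N.
Proof. exact: card_pprimeChar fchar_pchar. Qed.

Local Notation s := (logn p #|F|).

Definition field_trace (x : F) := \sum_(i < s) x ^+ (p ^ i).

Lemma FrobD n : {morph (fun x : F => x ^+ (p ^ n)) : x y / x + y}.
Proof.
move=> x y; rewrite exprDn_pchar // pnatX pnatE ?fchar_prime //.
by rewrite fchar_pchar.
Qed.

Lemma field_traceD x y : field_trace (x + y) = field_trace x + field_trace y.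
Proof. by rewrite /field_trace -big_split; apply: eq_bigr => i _; rewrite FrobD. Qed.

Lemma field_traceX x : field_trace x ^+ p = field_trace x.
Proof.
have pe : field_trace x ^+ p = \sum_(i < s) x ^+ (p ^ i.+1).
  have F0 : (0 : F) ^+ (p ^ 1) = 0.
    by rewrite expr0n expn1 eqn0Ngt prime_gt0 ?fchar_prime.
  rewrite /field_trace -[X in _ ^+ X]expn1 (big_morph _ (FrobD 1) F0).
  by apply: eq_bigr => i _; rewrite -exprM expn1 expnSr.
rewrite pe /field_trace.
have := card_fchar; case: s => [|s'] cF; first by rewrite !big_ord0.
rewrite big_ord_recr [RHS]big_ord_recl /= expn0 expr1 addrC; congr (_ + _).
  by rewrite -cF expf_card.
Qed.

Lemma natr_eq_mod m n : (m%:R == n%:R :> F) = (m == n %[mod p]).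
Proof.
wlog le_nm : m n / (n <= m)%N.
  by move=> W; case/orP: (leq_total n m) => /W // E; rewrite eq_sym E eq_sym.
by rewrite eqn_mod_dvd // (dvdn_pcharf fchar_pchar) natrB // subr_eq0.
Qed.

(** The default 0 of [abs_trace] is never taken: the trace is a root of X^p - X, whose p roots are
    already the integers below p. *)
Lemma abs_traceE x : (abs_trace x : nat)%:R = field_trace x.
Proof.
rewrite /abs_trace; case: pickP => [z /eqP|noz] //=; exfalso.
have p_pr := fchar_prime.
have sp : size ('X^p - 'X : {poly F}) = p.+1.
  by rewrite size_polyDl size_polyXn // size_polyN size_polyX ltnS prime_gt1.
have np : ('X^p - 'X : {poly F}) != 0 by rewrite -size_poly_eq0 sp.
have := @max_poly_roots _ _ (field_trace x :: [seq k%:R | k <- iota 0 p]) np.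
rewrite /= size_map size_iota sp ltnn => H; suff: false by []; apply: H.
  rewrite rootE !hornerE field_traceX subrr eqxx /=.
  apply/allP => _ /mapP[k _ ->]; rewrite rootE !hornerE -natrX subr_eq0.
  by rewrite natr_eq_mod fermat_little.
rewrite map_inj_in_uniq ?iota_uniq ?andbT => [|k l].
  apply/mapP => -[k]; rewrite mem_iota /= add0n => kp Tk.
  have pk : (k < (Zp_trunc (pdiv p)).+2)%N by rewrite Fp_cast.
  by have /eqP := noz (Ordinal pk); apply; rewrite /= -Tk.
rewrite !mem_iota !add0n => /= kp lp /eqP.
by rewrite natr_eq_mod !modn_small // => /eqP.
Qed.

Definition addchar (x : F) : R[i] := omega R F ^+ abs_trace x.

Lemma addcharE x n : field_trace x = n%:R -> addchar x = omega R F ^+ n.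
Proof.
rewrite -abs_traceE => /eqP; rewrite natr_eq_mod => /eqP E.
by rewrite /addchar -(expr_mod _ omega_fchar) E expr_mod ?omega_fchar.
Qed.

Lemma addcharD : {morph addchar : x y / x + y >-> x * y}.
Proof.
move=> x y; rewrite -exprD; apply: addcharE.
by rewrite field_traceD natrD !abs_traceE.
Qed.

Lemma addchar0 : addchar 0 = 1.
Proof.
rewrite -[1](expr0 (omega R F)); apply: addcharE; rewrite /field_trace big1 // => i _.
by rewrite expr0n expn_eq0 eqn0Ngt prime_gt0 ?fchar_prime.
Qed.

(** As a polynomial the trace has degree below #|F|, so it is nonzero somewhere; since [omega] has
    order exactly p, the character differs from 1 there. *)
Lemma addchar_nontrivial : exists x, addchar x != 1.
Proof.
have p_pr := fchar_prime.
have s0 : (0 < s)%N.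
  by rewrite lt0n; apply: contraTneq (finNzRing_gt1 F) => s0; rewrite card_fchar s0.
pose P : {poly F} := \sum_(i < s) 'X^(p ^ i).
have sP : size P = (p ^ s.-1).+1.
  rewrite /P -[s in LHS](prednK s0) big_ord_recr /= addrC size_polyDl ?size_polyXn //.
  rewrite ltnS; apply: leq_trans (size_sum _ _ _) _; apply/bigmax_leqP => i _.
  by rewrite size_polyXn ltn_exp2l ?prime_gt1.
have P0 : P != 0 by rewrite -size_poly_eq0 sP.
have [x Px] : exists x, ~~ root P x.
  apply/existsP; rewrite -negb_forall; apply/negP => /forallP Px.
  have := max_poly_roots P0 (rs := enum F); rewrite enum_uniq -cardE sP.
  have -> : all (root P) (enum F) by apply/allP => x _; apply: Px.
  move=> /(_ isT isT); rewrite ltnS {1}card_fchar leq_exp2l ?prime_gt1 //.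
  by rewrite leqNgt ltn_predL s0.
exists x; rewrite /addchar.
have Tx : field_trace x != 0.
  by move: Px; rewrite rootE /P horner_sum /field_trace; under eq_bigr do rewrite hornerXn.
have [l l_prim l_p] := prim_order_exists (prime_gt0 p_pr) omega_fchar.
rewrite -(prim_order_dvd l_prim); apply: contra Tx => l_t.
move/primeP: p_pr l_p => [_ /[apply]] /orP[/eqP l1|/eqP lp].
  by have := prim_expr_order l_prim; rewrite l1 expr1 => /eqP; rewrite (negPf omega_neq1).
by rewrite -abs_traceE -(dvdn_pcharf fchar_pchar); move: l_t; rewrite lp.
Qed.

End AdditiveCharacter.

Lemma linfun_linear (K : fieldType) (aT rT : vectType K) (h : aT -> rT) :
  linear h -> linfun h =1 h.
Proof.
move=> lin_h; exact: (lfunE (HB.pack_for {linear aT -> rT} h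
  (GRing.isLinear.Build _ _ _ _ h lin_h))).
Qed.

(** * Action of the Pauli operators on functions *)

Section Paulis.

Variables (R : realType) (F : finFieldType).

Local Notation C := (R[i]).

Lemma op_of_ketsE (T : finType) (A : T -> hilb R T) (f : hilb R T) :
  op_of_kets A f = \sum_x f x *: A x.
Proof.
rewrite /op_of_kets linfun_linear // => a u v.
rewrite scaler_sumr -big_split; apply: eq_bigr => x _.
by rewrite !ffunE /= scalerDl scalerA.
Qed.

Lemma op_of_kets_ket (T : finType) (A : T -> hilb R T) (x : T) :
  op_of_kets A (ket R x) = A x.
Proof.
rewrite op_of_ketsE (bigD1 x) //= big1 ?addr0 => [|y yx].
  by rewrite ffunE eqxx scale1r.
by rewrite ffunE (negPf yx) scale0r.
Qed.

Lemma pauliXZ_ket (a b x y : F) :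
  (pauliX R a \o pauliZ R b)%VF (ket R x) y =
    addchar R (b * x) * (y == x + a)%:R.
Proof.
by rewrite comp_lfunE op_of_kets_ket linearZ /= op_of_kets_ket !ffunE.
Qed.

Definition rvdot N (b x : 'rV[F]_N) : F := (b *m x^T) 0 0.

Lemma rvdotE N (b x : 'rV[F]_N) : rvdot b x = \sum_i b 0 i * x 0 i.
Proof. by rewrite /rvdot mxE; apply: eq_bigr => i _; rewrite mxE. Qed.

Lemma pauliEE N (a b : 'rV[F]_N) (f : nqudits R F N) y :
  pauliE R a b f y = addchar R (rvdot b (y - a)) * f (y - a).
Proof.
rewrite op_of_ketsE sum_ffunE (bigD1 (y - a)) //= big1 ?addr0 => [|x xya].
  rewrite !ffunE mulrC; congr (_ * _).
  rewrite rvdotE (big_morph _ (@addcharD R F) (addchar0 R F)).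
  by apply: eq_bigr => i _; rewrite pauliXZ_ket !mxE subrK eqxx mulr1.
have [i xi] : exists i, y 0 i != x 0 i + a 0 i.
  apply/existsP; rewrite -negb_forall; apply: contra xya => /forallP xya.
  by apply/eqP/rowP => i; rewrite !mxE (eqP (xya i)) addrK.
rewrite !ffunE (bigD1 i isT) pauliXZ_ket (negPf xi) mulr0.
by rewrite /= mul0r scaler0.
Qed.

End Paulis.

(** * CSS codes *)

Section CSS.

Variables (R : realType) (F : finFieldType) (N k : nat) (H : 'M[F]_(k, N)).
Hypothesis H_so : H *m H^T = 0.

Local Notation hilbN := (nqudits R F N).
Local Notation inC y := (y *m H^T == 0).
Local Notation c0 := (#|{: 'rV[F]_k}|%:R^-1 : R[i]).

(** This is the average of the operators [pauliE a b] for [a], [b] in the row space of [H]: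
    averaging over [b] yields the factor [inC y], over [a] the mean on a coset. *)
Definition css_proj : 'End(hilbN) := linfun (fun f : hilbN =>
  [ffun y : 'rV[F]_N => (inC y)%:R * (c0 * \sum_(u : 'rV[F]_k) f (y + u *m H))]
  : hilbN).

Lemma css_projE (f : hilbN) y :
  css_proj f y = (inC y)%:R * (c0 * \sum_(u : 'rV[F]_k) f (y + u *m H)).
Proof.
have key (z1 z2 a s1 s2 : R[i]) :
    z1 * (z2 * (a * s1 + s2)) = a * (z1 * (z2 * s1)) + z1 * (z2 * s2).
  by rewrite !mulrDr (mulrCA z2) (mulrCA z1).
rewrite linfun_linear ?ffunE // => a u v; apply/ffunP => x; rewrite !ffunE.
apply: etrans (key _ _ _ _ _); congr (_ * (_ * _)).
by rewrite mulr_sumr -big_split; apply: eq_bigr => w _; rewrite !ffunE.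
Qed.

Lemma c0_neq0 : c0 != 0.
Proof. by rewrite invr_eq0 pnatr_eq0 -lt0n; apply/card_gt0P; exists 0. Qed.

Lemma inC_shift y (v : 'rV[F]_k) : inC (y + v *m H) = inC y.
Proof. by rewrite mulmxDl -mulmxA H_so mulmx0 addr0. Qed.

Lemma css_proj_shift f y (v : 'rV[F]_k) : css_proj f (y + v *m H) = css_proj f y.
Proof.
rewrite !css_projE inC_shift (reindex_inj (addIr (- v))) /=.
congr (_ * (_ * _)); apply: eq_bigr => u _.
by rewrite mulmxBl addrACA subrr addr0.
Qed.

Lemma css_proj_out f y : ~~ inC y -> css_proj f y = 0.
Proof. by rewrite css_projE => /negPf ->; rewrite mul0r. Qed.

(** Describes the code itself: functions supported on the kernel and constant on cosets of the row
    space. *)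
Lemma css_proj_id (f : hilbN) :
    (forall y, ~~ inC y -> f y = 0) ->
    (forall y (v : 'rV[F]_k), f (y + v *m H) = f y) ->
  css_proj f = f.
Proof.
move=> fC fH; apply/ffunP => y; rewrite css_projE.
case yC: (inC y); last by rewrite mul0r fC ?yC.
under eq_bigr do rewrite fH.
rewrite sumr_const mul1r -(mulr_natl (f y : R[i])) mulKf //.
by rewrite -invr_eq0 c0_neq0.
Qed.

Lemma css_proj_idem f : css_proj (css_proj f) = css_proj f.
Proof. by apply: css_proj_id => [y /css_proj_out|y v]; last exact: css_proj_shift. Qed.

(** Moving [y] by a row combination transfers the shift from [f] to [g]; [inC] is unchanged by such
    moves, and [u] runs over a set stable under negation. *)
Lemma css_proj_adj f g : inner (css_proj f) g = inner f (css_proj g).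
Proof.
rewrite /inner.
transitivity (\sum_y \sum_u (inC y)%:R * c0 * f (y + u *m H) * (g y)^*%C).
  by apply: eq_bigr => y _; rewrite css_projE mulrA mulr_sumr mulr_suml.
rewrite exchange_big.
transitivity (\sum_y \sum_u (inC y)%:R * c0 * f y * (g (y + u *m H))^*%C); last first.
  apply: eq_bigr => y _; rewrite css_projE rmorphM rmorphM fmorphV !rmorph_nat rmorph_sum /=.
  rewrite mulrA mulr_sumr mulr_sumr; apply: eq_bigr => u _.
  by rewrite !mulrA; congr (_ * _); rewrite mulrC mulrA.
rewrite [RHS]exchange_big (reindex_inj (@oppr_inj _)) /=.
apply: eq_bigr => u _; rewrite (reindex_inj (addIr (u *m H))) /=.
by apply: eq_bigr => y _; rewrite inC_shift mulNmx addrK.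
Qed.

Lemma css_orthogonal_projector : orthogonal_projector (limg css_proj) css_proj.
Proof.
move=> f; split=> [|_ /memv_imgP[v _ ->]]; first exact/memv_img/memvf.
rewrite -css_proj_adj linearB /= css_proj_idem subrr /inner big1 // => x _.
by rewrite ffunE mul0r.
Qed.

Hypothesis H_free : row_free H.

(** [E] is a complement of the row space in the kernel, of rank N - 2k. A code vector is an
    arbitrary function of the [E]-coordinates, which [lsubmx (pinvmx B)] extracts, so the dimension
    is the number of cosets. *)
Lemma css_dim : \dim (limg css_proj) = (#|F| ^ (N - 2 * k))%N.
Proof.
pose K := kermx H^T; pose E := (K :\: H)%MS; pose B := col_mx (row_base E) H.
have H_K : (H <= K)%MS by apply/sub_kermxP.
have rH : \rank H = k by apply/eqP.
have rE : \rank E = (N - 2 * k)%N.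
  have := mxrank_cap_compl K H.
  rewrite (capmx_idPr H_K) mxrank_ker mxrank_tr rH mul2n -addnn subnDA => <-.
  by rewrite addKn.
have capEH : (row_base E :&: H)%MS = 0.
  by apply/eqP; rewrite -submx0 -(capmx_diff K H) capmxS // eq_row_base.
have BE : (B :=: K)%MS.
  apply: eqmx_trans (eqmx_sym (addsmxE _ _)) _.
  apply: eqmx_trans (adds_eqmx (eq_row_base _) (eqmx_sym (capmx_idPr H_K))) _.
  exact: addsmx_diff_cap_eq.
have B_free : row_free B.
  by rewrite /row_free -addsmxE mxrank_disjoint_sum // rH (eqP (row_base_free _)).
have inCE y : inC y = (y <= B)%MS by rewrite BE; apply/eqP/sub_kermxP.
pose L := linfun (fun h : hilb R 'rV[F]_(\rank E) =>
  [ffun y : 'rV[F]_N => (inC y)%:R * h (y *m lsubmx (pinvmx B))] : hilbN).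
have LE h y : L h y = (inC y)%:R * h (y *m lsubmx (pinvmx B)).
  rewrite linfun_linear ?ffunE // => a u v; apply/ffunP => x; rewrite !ffunE.
  by rewrite mulrDr; congr (_ + _); exact: mulrCA.
have BK (e : 'rV_(\rank E)) (v : 'rV_k) :
    (e *m row_base E + v *m H) *m lsubmx (pinvmx B) = e.
  by rewrite -mul_row_col mulmx_lsub (mulmxKp B_free) row_mxKl.
have L_inj : (lker L == 0)%VS.
  apply/lker0P => h h' /ffunP Lhh'; apply/ffunP => e.
  have := Lhh' (e *m row_base E + 0 *m H).
  by rewrite !LE BK inCE -mul_row_col submxMl !mul1r.
have -> : limg css_proj = limg L.
  apply/eqP; rewrite eqEsubv; apply/andP; split; apply/subvP.
    move=> _ /memv_imgP[v _ ->].
    pose h : hilb R 'rV[F]_(\rank E) := [ffun e => css_proj v (e *m row_base E)].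
    suff -> : css_proj v = L h by exact/memv_img/memvf.
    apply/ffunP => y; rewrite LE ffunE.
    case yC: (inC y); last by rewrite mul0r css_proj_out ?yC.
    rewrite mul1r -[in LHS](mulmxKpV (_ : (y <= B)%MS)) -?inCE //.
    rewrite -[y *m pinvmx B]hsubmxK mul_row_col css_proj_shift.
    by rewrite mulmx_lsub.
  move=> _ /memv_imgP[h _ ->].
  suff -> : L h = css_proj (L h) by exact/memv_img/memvf.
  symmetry; apply: css_proj_id => [y yC|y v]; first by rewrite LE (negPf yC) mul0r.
  rewrite !LE inC_shift; case yC: (inC y); last by rewrite !mul0r.
  rewrite inCE in yC.
  rewrite -(mulmxKpV yC) -[y *m pinvmx B]hsubmxK mul_row_col -addrA -mulmxDl.
  by rewrite !BK.
rewrite limg_dim_eq; last by rewrite (eqP L_inj) capv0.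
rewrite dimvf -rE.
transitivity (#|{: 'rV[F]_(\rank E)}| * 1)%N; first by [].
by rewrite card_mx mul1n muln1.
Qed.

Lemma rvdotDr (b x y : 'rV[F]_N) : rvdot b (x + y) = rvdot b x + rvdot b y.
Proof. by rewrite /rvdot linearD mulmxDr mxE. Qed.

Lemma rvdot_row_combination (b : 'rV[F]_N) (u : 'rV[F]_k) :
  rvdot b (u *m H) = rvdot (b *m H^T) u.
Proof. by rewrite /rvdot trmx_mul mulmxA. Qed.

Lemma rvdot_surj n (b : 'rV[F]_n) z : b != 0 -> exists u, rvdot b u = z.
Proof.
case/rV0Pn=> i bi; exists ((z / b 0 i) *: delta_mx 0 i).
rewrite rvdotE (bigD1 i) //= big1 ?addr0 => [|j ji].
  by rewrite !mxE !eqxx mulr1 mulrC divfK.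
by rewrite !mxE (negPf ji) andbF !mulr0.
Qed.

(** Translation by a [v] at which the character is not 1 multiplies the sum by that value while
    preserving it. *)
Lemma sum_addchar_rows (b : 'rV[F]_N) : ~~ inC b ->
  \sum_(u : 'rV[F]_k) addchar R (rvdot b (u *m H)) = 0.
Proof.
move=> bC; have [z z1] := addchar_nontrivial R F.
have [v vz] := rvdot_surj z bC.
apply/eqP; move: z1; apply: contraNT => S0; apply/eqP/(mulIf S0).
rewrite mul1r [RHS](reindex_inj (addIr v)) mulr_sumr /=.
apply: eq_bigr => u _.
by rewrite mulmxDl rvdotDr addcharD [in RHS]mulrC -vz !rvdot_row_combination.
Qed.

(** Since [css_proj f] is constant on cosets, averaging over a coset affects only the phase, and a
    character sum splits off. *)
Lemma css_sandwichE a b f y : (css_proj \o pauliE R a b \o css_proj)%VF f y =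
  (inC y)%:R * (c0 * ((\sum_(u : 'rV[F]_k) addchar R (rvdot b (u *m H)))
    * (addchar R (rvdot b (y - a)) * (css_proj f (y - a) : R[i])))).
Proof.
rewrite !comp_lfunE css_projE; congr (_ * (_ * _)).
rewrite [RHS](mulr_suml (R := R[i])); apply: eq_bigr => u _.
rewrite pauliEE addrAC css_proj_shift rvdotDr addcharD.
by rewrite mulrA; congr (_ * _); rewrite mulrC.
Qed.

(** If [a] is outside the kernel, the shift moves the support off the kernel; if [b] is, the
    character sum vanishes. *)
Lemma css_sandwich0 a b : ~~ (inC a && inC b) ->
  (css_proj \o pauliE R a b \o css_proj)%VF = 0.
Proof.
move=> abC; apply/lfunP => f; apply/ffunP => y; rewrite css_sandwichE lfunE ffunE.
case yC: (inC y); last by rewrite mul0r.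
move: abC; rewrite negb_and => /orP[aC | bC].
  by rewrite css_proj_out ?mulr0 // mulmxDl (eqP yC) add0r mulNmx oppr_eq0.
by rewrite sum_addchar_rows // mul0r !mulr0.
Qed.

Lemma css_sandwichZ b f y : inC b ->
  (css_proj \o pauliE R 0 b \o css_proj)%VF f y =
    addchar R (rvdot b y) * css_proj f y.
Proof.
move=> bC; rewrite css_sandwichE subr0.
rewrite (eq_bigr (fun _ => 1)) => [|u _]; last first.
  by rewrite rvdot_row_combination (eqP bC) /rvdot mul0mx mxE addchar0.
have c01 : c0 * #|{: 'rV[F]_k}|%:R = 1 by rewrite mulVf // -invr_eq0 c0_neq0.
rewrite sumr_const (mulrA c0) c01 mul1r.
by case yC: (inC y); rewrite ?mul1r // mul0r css_proj_out ?yC ?mulr0.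
Qed.

Lemma css_proj_ket_neq0 x : inC x -> css_proj (ket R x) x != 0.
Proof.
move=> xC; rewrite css_projE xC mul1r mulf_neq0 ?c0_neq0 //.
under eq_bigr do rewrite ffunE.
by rewrite -natr_sum pnatr_eq0 (bigD1 0) //= mul0mx addr0 eqxx.
Qed.

(** Double annihilator: a [w] outside the row space pairs nontrivially with a column of the
    cokernel, which lies in the kernel and can be scaled to reach any field element. *)
Lemma addchar_dual (w : 'rV[F]_N) :
  (forall x, inC x -> addchar R (rvdot w x) = 1) -> (w <= H)%MS.
Proof.
move=> w1; rewrite submxE; apply: contraT => /rV0Pn[j wj].
have [z /eqP[]] := addchar_nontrivial R F.
pose x := (z / (w *m cokermx H) 0 j) *: row j (cokermx H)^T.
have <- : rvdot w x = z.
  rewrite /rvdot /x linearZ /= -scalemxAr mxE.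
  rewrite [in X in _ * X]mxE -[RHS](divfK wj); congr (_ * _); rewrite mxE.
  by apply: eq_bigr => i _; rewrite !mxE.
by apply: w1; rewrite -scalemxAl -row_mul -trmx_mul mulmx_coker trmx0 row0 scaler0.
Qed.

(* A set of k independent columns of H can be solved for: row i of W is the  *)
(* unit vector at i, corrected on these k columns.                           *)
Lemma low_weight_generators : exists W : 'M[F]_N,
  [/\ W *m H^T = 0,
      forall n (X : 'M[F]_(n, N)), X *m H^T = 0 -> X *m W = X
    & forall i, (#|[set j | W i j != 0%R]| <= k.+1)%N].
Proof.
have Hfull : row_full H^T by rewrite /row_full mxrank_tr.
pose f := fullrankfun Hfull; pose B := rowsub f H^T.
have B_unit : B \in unitmx := fullrowsub_unit Hfull.
exists (1%:M - H^T *m (invmx B *m rowsub f 1%:M)); split=> [|n X XH|i].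
- by rewrite mulmxBl mul1mx -!mulmxA -rowsubE mulVmx // mulmx1 subrr.
- by rewrite mulmxBr mulmx1 mulmxA XH mul0mx subr0.
apply: (@leq_trans #|i |: [set f l | l in 'I_k]|); last first.
  rewrite cardsU1 -add1n leq_add ?leq_b1 //.
  by rewrite (leq_trans (leq_imset_card _ _)) // card_ord.
apply/subset_leq_card/fintype.subsetP => j; rewrite !inE.
apply: contraR; rewrite negb_or => /andP[ji jf].
rewrite mulmxA !mxE [i == j]eq_sym (negPf ji) sub0r oppr_eq0 big1 // => l _.
rewrite [rowsub _ _ _ _]mxE [1%:M _ _]mxE; case: eqP => [fl|_]; last by rewrite mulr0.
by rewrite -fl imset_f in jf.
Qed.

End CSS.

(** * Weights of errors and the parameters of the CSS code *)

Section Weights.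

Variables (F : finFieldType) (N : nat).

Definition row_weight (x : 'rV[F]_N) : nat := #|[set i | x 0 i != 0%R]|.

Lemma row_weight_lel (a b : 'rV[F]_N) : (row_weight a <= weight a b)%N.
Proof.
by apply/subset_leq_card/fintype.subsetP => i; rewrite !inE; apply: contra => /eqP[->].
Qed.

Lemma row_weight_ler (a b : 'rV[F]_N) : (row_weight b <= weight a b)%N.
Proof.
by apply/subset_leq_card/fintype.subsetP => i; rewrite !inE; apply: contra => /eqP[_ ->].
Qed.

Lemma weight0l (b : 'rV[F]_N) : weight 0 b = row_weight b.
Proof. by apply: eq_card => i; rewrite !inE mxE xpair_eqE eqxx. Qed.

Lemma row_weight_gt0 (x : 'rV[F]_N) : x != 0 -> (0 < row_weight x)%N.
Proof. by case/rV0Pn=> i xi; apply/card_gt0P; exists i; rewrite inE. Qed.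

End Weights.

Lemma css_code (R : realType) (F : finFieldType) (N k d : nat)
    (H : 'M[F]_(k, N)) :
    (0 < k)%N -> row_free H -> H *m H^T = 0 ->
    (forall x : 'rV[F]_N, x *m H^T = 0 -> x != 0 -> (d <= row_weight x)%N) ->
  exists (d' : nat) (U : {vspace nqudits R F N}),
    quantum_code (N - 2 * k) d' U /\ (d <= d' <= k.+1)%N.
Proof.
move=> k_gt0 H_free H_so d_min.
pose P := css_proj R H; pose K := (N - 2 * k)%N.
have big_weight x : x != 0 -> (row_weight x < d)%N -> (x *m H^T == 0) = false.
  by move=> x0; rewrite ltnNge; apply: contraNF => /eqP xC; apply: d_min.
have P_d : detects_below K P d.
  move=> a b w_ab.
  have [/andP[/eqP-> /eqP->]|ab0] := boolP ((a == 0) && (b == 0)).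
    rewrite weight0l /row_weight; case: ifP => _.
      by case/card_gt0P => i; rewrite inE mxE eqxx.
    exists 1; rewrite scale1r; apply/lfunP => f; apply/ffunP => y.
    rewrite css_sandwichZ // ?mul0mx //.
    by rewrite /rvdot mul0mx mxE addchar0 mul1r.
  suff PEP : (P \o pauliE R a b \o P)%VF = 0.
    by case: ifP => // _; exists 0; rewrite scale0r.
  apply: css_sandwich0 => //; move: ab0; rewrite !negb_and.
  case/orP => [a0|b0]; apply/orP; [left|right]; rewrite big_weight //.
    exact: leq_ltn_trans (row_weight_lel _ _) w_ab.
  exact: leq_ltn_trans (row_weight_ler _ _) w_ab.
have [W [WH W_id W_weight]] := low_weight_generators H_free.
have WrowC i : row i W *m H^T == 0 by rewrite -row_mul WH row0.
have P_bound d' : detects_below K P d' -> (d' <= k.+1)%N.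
  move=> Pd'; rewrite leqNgt; apply/negP => d'_gt.
  have Wrow_weight i : (weight 0 (row i W) < d')%N.
    apply: leq_ltn_trans d'_gt; rewrite weight0l; apply: leq_trans (W_weight i).
    by apply/subset_leq_card/fintype.subsetP => j; rewrite !inE mxE.
  (* If K = 0, a nonzero row of [W] would be a phase error whose sandwich is nonzero on the
     projection of [ket R 0]. So [W = 0], hence [H = H *m W = 0], against k > 0. *)
  case: (eqVneq K 0%N) => K0.
    have W0 : W = 0.
      apply/row_matrixP => i; rewrite row0; apply/eqP/negPn/negP => Wi0.
      have := Pd' 0 (row i W) (Wrow_weight i); rewrite K0 eqxx weight0l.
      move=> /(_ (row_weight_gt0 Wi0)).
      move=> /(congr1 (fun A : 'End(nqudits R F N) => A (ket R 0) 0)).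
      rewrite css_sandwichZ // lfunE ffunE /rvdot linear0 mulmx0 mxE addchar0 mul1r.
      by apply/eqP/css_proj_ket_neq0; rewrite ?mul0mx.
    have := W_id _ H H_so; rewrite W0 mulmx0 => H0.
    by move: H_free k_gt0; rewrite /row_free -H0 mxrank0 eq_sym => /eqP ->.
  (* If K > 0, the phase of a row of [W] equals the scalar [c] on the whole kernel, and it is 1 at
     0; thus the row lies in the row space. The kernel would then have rank at most k, forcing N <=
     2k. *)
  have W_H : (W <= H)%MS.
    apply/row_subP => i; apply: (addchar_dual (R := R)) => x xC.
    have := Pd' 0 (row i W) (Wrow_weight i); rewrite (negPf K0) => -[c PEP].
    have cE y : y *m H^T == 0 -> addchar R (rvdot (row i W) y) = c.
      move=> yC; apply: (mulIf (css_proj_ket_neq0 R yC)).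
      by rewrite -css_sandwichZ // PEP lfunE ffunE.
    rewrite cE // -(cE 0) ?mul0mx //.
    by rewrite /rvdot linear0 mulmx0 mxE addchar0.
  have : (kermx H^T <= H)%MS.
    by rewrite -(W_id _ (kermx H^T) (mulmx_ker _)) (submx_trans (submxMl _ _)).
  move/mxrankS; rewrite mxrank_ker mxrank_tr (eqP H_free) leq_subLR.
  by rewrite addnn -mul2n -subn_eq0 -/K (negPf K0).
(* The exact distance is the largest detected bound, which exists because [P_bound] caps it. *)
pose D d' := `[< detects_below K P d' >].
have exD : exists d', D d' by exists d; apply/asboolP.
have D_bound d' : D d' -> (d' <= k.+1)%N by move/asboolP/P_bound.
case: (ex_maxnP exD D_bound) => d' /asboolP Pd' d'_max.
exists d', (limg P); split; last first.
  by rewrite P_bound // d'_max //; apply/asboolP.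
split; first exact: css_dim.
exists P; split=> // [|d'' Pd'']; first exact: css_orthogonal_projector.
by apply: d'_max; apply/asboolP.
Qed.

(** * Sums of monomials over F^s *)

(** For a = 0 the sum is #|F| = 0 in F, with 0^0 = 1. Otherwise X^a - 1 has too few roots to vanish
    on all nonzero elements, and scaling by a [t] with t^a not 1 kills the sum. *)
Lemma sum_expf (F : finFieldType) a :
  (a < #|F|.-1)%N -> \sum_(t : F) t ^+ a = 0.
Proof.
case: a => [|a] a_lt.
  under eq_bigr do rewrite expr0.
  rewrite sumr_const; apply/eqP; rewrite -(dvdn_pcharf (fchar_pchar F)).
  exact: pdiv_dvd.
have [t t0 ta] : exists2 t : F, t != 0 & t ^+ a.+1 != 1.
  apply/exists_inP; rewrite -negb_forall_in; apply/negP => /forall_inP all1.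
  have := @max_poly_roots F ('X^(a.+1) - 1) (enum [pred t : F | t != 0]).
  rewrite -size_poly_eq0 size_XnsubC // enum_uniq -cardE => /(_ isT).
  rewrite -[#|_|]/#|predC1 (0 : F)| cardC1 ltnS leqNgt a_lt => H.
  suff: false by []; apply: H => //; apply/allP => t; rewrite mem_enum => /all1/eqP ta.
  by rewrite rootE !hornerE ta subrr.
apply/eqP; move: ta; apply: contraNT => S0; apply/eqP/(mulIf S0).
rewrite mul1r [RHS](reindex_inj (mulfI t0)) mulr_sumr.
by apply: eq_bigr => u _; rewrite exprMn.
Qed.

Lemma sum_monomial (F : finFieldType) (I : finType) (e : I -> nat) i :
    (e i < #|F|.-1)%N ->
  \sum_(c : {ffun I -> F}) \prod_k c k ^+ e k = 0.
Proof.
move=> ei; rewrite -(bigA_distr_bigA (fun k t => t ^+ e k)).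
by rewrite (bigD1 i) //= sum_expf // mul0r.
Qed.

(** As long as t < s, the combinations of t vectors number #|F|^t < #|G|, so an independent family
    extends; at t = s injectivity and equal cardinals give the bijection. *)
Lemma field_basis (F G : finFieldType) (emb : {rmorphism F -> G}) s :
    #|G| = (#|F| ^ s)%N ->
  exists e : 'I_s -> G,
    bijective (fun c : {ffun 'I_s -> F} => \sum_i emb (c i) * e i).
Proof.
move=> cardG.
suff: forall t, (t <= s)%N -> exists e : nat -> G, forall c : nat -> F,
    \sum_(i < t) emb (c i) * e i = 0 -> forall i, (i < t)%N -> c i = 0.
  case/(_ s (leqnn s)) => e e_free; exists (fun i => e i).
  apply: inj_card_bij; last by rewrite cardG card_ffun card_ord.
  move=> c c' /eqP; rewrite -subr_eq0 -sumrB => /eqP cc'.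
  pose d i := if insub i is Some k then c k - c' k else 0.
  have dE (k : 'I_s) : d k = c k - c' k by rewrite /d valK.
  apply/ffunP => k; apply/eqP; rewrite -subr_eq0 -dE.
  rewrite (e_free d) // -[RHS]cc'; apply: eq_bigr => i _.
  by rewrite dE rmorphB mulrBl.
elim=> [|t IHt] lt_ts; first by exists (fun=> 0).
have [e e_free] := IHt (ltnW lt_ts).
pose h (c : {ffun 'I_t -> F}) := \sum_i emb (c i) * e i.
have [z z_h] : exists z, z \notin codom h.
  apply/existsP; rewrite -negb_forall; apply/negP => /forallP h_onto.
  have: (#|G| <= #|{ffun 'I_t -> F}|)%N.
    apply: leq_trans (leq_image_card h _).
    by apply/subset_leq_card/fintype.subsetP => x _; apply: h_onto.
  by rewrite cardG card_ffun card_ord leqNgt ltn_exp2l ?lt_ts ?finNzRing_gt1.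
exists (fun i => if i == t then z else e i) => c.
rewrite big_ord_recr /= eqxx => c0.
have {}c0 : \sum_(i < t) emb (c i) * e i + emb (c t) * z = 0.
  rewrite -[RHS]c0; congr (_ + _); apply: eq_bigr => i _.
  by rewrite (ltn_eqF (ltn_ord i)).
have ct : c t = 0.
  apply/eqP; move: z_h; apply: contraNT => ct; apply/codomP.
  exists [ffun i : 'I_t => - c i / c t].
  have embct : emb (c t) != 0 by rewrite fmorph_eq0.
  apply: (mulfI embct).
  rewrite -[LHS](addKr (\sum_(i < t) emb (c i) * e i)) c0 addr0 -sumrN mulr_sumr.
  apply: eq_bigr => i _; rewrite ffunE mulrA -rmorphM (mulrC (c t)).
  by rewrite divfK // rmorphN mulNr.
move=> i; rewrite ltnS leq_eqVlt => /orP[/eqP->//|it].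
by apply: e_free it; move: c0; rewrite ct rmorph0 mul0r addr0.
Qed.

(** * The matrix of affine functions on F^s *)

Section AffineMatrix.

Variables (F : finFieldType) (s N : nat) (tau : 'I_N -> {ffun 'I_s -> F}).

Definition affine_monomial (i : 'I_s.+1) (c : {ffun 'I_s -> F}) : F :=
  oapp c 1 (unlift ord0 i).

Lemma affine_monomialE i c : affine_monomial i c =
  \prod_k c k ^+ (unlift ord0 i == Some k).
Proof.
rewrite /affine_monomial; case: unlift => [k|] /=; last by rewrite big1.
rewrite (bigD1 k) //= eqxx big1 ?mulr1 // => l lk.
by rewrite (inj_eq Some_inj) eq_sym (negPf lk).
Qed.

Definition affine_mx : 'M[F]_(s.+1, N) :=
  \matrix_(i, j) affine_monomial i (tau j).

Hypothesis tau_bij : bijective tau.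

Lemma affine_mx_free : row_free affine_mx.
Proof.
have [tau' tauK tau'K] := tau_bij.
apply: inj_row_free => v vH0.
have v0 (c : {ffun 'I_s -> F}) : v 0 ord0 + \sum_k v 0 (lift ord0 k) * c k = 0.
  have := congr1 (fun A : 'rV[F]_N => A 0 (tau' c)) vH0; rewrite !mxE big_ord_recl.
  rewrite !mxE tau'K /affine_monomial unlift_none mulr1 => vc; rewrite -[RHS]vc.
  by congr (_ + _); apply: eq_bigr => k _; rewrite !mxE tau'K /affine_monomial liftK.
have v00 : v 0 ord0 = 0.
  by have := v0 [ffun=> 0]; rewrite big1 ?addr0 // => k _; rewrite ffunE mulr0.
apply/rowP => i; rewrite mxE; case: (unliftP ord0 i) => [k|] -> //.
have := v0 [ffun l => (l == k)%:R]; rewrite v00 add0r (bigD1 k) //= ffunE eqxx mulr1.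
by rewrite big1 ?addr0 // => l lk; rewrite ffunE (negPf lk) mulr0.
Qed.

(** The exponents in a product of two rows add up to at most 2 < s(q-1), so some variable has
    exponent below q-1, and summing over it gives 0. *)
Lemma affine_mx_self_orthogonal :
  (2 < s * #|F|.-1)%N -> affine_mx *m affine_mx^T = 0.
Proof.
move=> sF; apply/matrixP => i i'; rewrite !mxE.
under eq_bigr do rewrite !mxE.
have [tau' tauK tau'K] := tau_bij.
rewrite (reindex tau') /=; last by exists tau => ? _.
under eq_bigr => c _.
  rewrite tau'K !affine_monomialE -big_split /=.
  under eq_bigr do rewrite -exprD.
  over.
pose e k : nat := ((unlift ord0 i == Some k) + (unlift ord0 i' == Some k))%N.
have [k ek] : exists k, (e k < #|F|.-1)%N.
  apply/existsP; apply: contraTT sF; rewrite negb_exists => /forallP e_ge.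
  rewrite -leqNgt.
  have le1 (o : option 'I_s) : (\sum_k (o == Some k : nat) <= 1)%N.
    case: o => [k|]; last by rewrite big1.
    by rewrite (bigD1 k) //= eqxx big1 // => l lk; rewrite (inj_eq Some_inj) eq_sym (negPf lk).
  apply: (@leq_trans (\sum_k e k)).
    rewrite -[s in leqLHS]card_ord -sum_nat_const; apply: leq_sum => k _.
    by rewrite leqNgt.
  by rewrite big_split /= (leq_add (le1 _) (le1 _)).
exact: (sum_monomial (e := e) ek).
Qed.

End AffineMatrix.

(** * Extended cyclic codes *)

Section ExtendedCodes.

Variables (F G : finFieldType) (emb : {rmorphism F -> G}) (n : nat).
Variables (beta : G) (g : {poly F}).
Hypothesis beta_prim : n.-primitive_root beta.
Hypothesis cardG : #|G| = n.+1.
Hypothesis g_dvd : g %| 'X^n - 1.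

Local Notation T := (defining_set emb n beta g).
Local Notation Chat := (extended_code n beta g).

Let n_gt0 : (0 < n)%N := prim_order_gt0 beta_prim.

Lemma beta_expr_inj : injective (fun i : 'I_n => beta ^+ i).
Proof.
move=> i j /eqP; rewrite (eq_prim_root_expr beta_prim) !modn_small // => /eqP.
exact: val_inj.
Qed.

Lemma beta_expr_neq0 i : beta ^+ i != 0.
Proof.
rewrite expf_neq0 //; apply: contraTneq n_gt0 => b0.
by have := prim_expr_order beta_prim; rewrite b0 expr0n;
  case: (n) => // k /eqP; rewrite eq_sym oner_eq0.
Qed.

Lemma sum_labels (V : zmodType) (f : G -> V) :
  \sum_X f X = f 0 + \sum_(i < n) f (beta ^+ i).
Proof.
rewrite (bigD1 0) //=; congr (_ + _).
have im : [set beta ^+ i | i : 'I_n] = [set~ 0].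
  apply/eqP; rewrite eqEcard; apply/andP; split.
    by apply/fintype.subsetP => _ /imsetP[i _ ->]; rewrite !inE beta_expr_neq0.
  rewrite (card_imset _ beta_expr_inj) card_ord.
  by have := cardsC1 (0 : G); rewrite cardG => ->.
rewrite -(big_imset (h := fun i : 'I_n => beta ^+ i) (A := predT) f) /=; last first.
  by move=> i j _ _; apply: beta_expr_inj.
apply: eq_bigl => X; have := congr1 (fun A : {set G} => X \in A) im.
by rewrite !inE => <-.
Qed.

(** The value at [beta ^+ t] of the polynomial of the unextended word: label 0 is left out, which
    matters only for t = 0. *)
Definition syndrome (x : {ffun G -> F}) (t : nat) : G :=
  \sum_(i < n) emb (x (beta ^+ i)) * beta ^+ (i * t).

Lemma syndrome_power_sum x t : (0 < t)%N ->
  syndrome x t = \sum_X emb (x X) * X ^+ t.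
Proof.
move=> t0; rewrite sum_labels expr0n eqn0Ngt t0 mulr0 add0r.
by apply: eq_bigr => i _; rewrite exprM.
Qed.

Lemma syndrome_mod x t : syndrome x (t %% n) = syndrome x t.
Proof.
apply: eq_bigr => i _; congr (_ * _).
by rewrite mulnC exprM prim_expr_mod // -exprM mulnC.
Qed.

Lemma syndrome_Frobenius x t l : syndrome x (t * #|F| ^ l) = syndrome x t ^+ (#|F| ^ l).
Proof.
have expF (a : F) : a ^+ (#|F| ^ l) = a.
  by elim: l => [|l IHl]; rewrite ?expn0 ?expr1 // expnSr exprM IHl expf_card.
have pG : [pchar G].-nat (#|F| ^ l)%N.
  have pF := fchar_pchar F.
  rewrite card_fchar -expnM pnatX pnatE ?fchar_prime //.
  by rewrite (fmorph_pchar emb) pF.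
have D : {morph (fun y : G => y ^+ (#|F| ^ l)) : y z / y + z}.
  by move=> y z; rewrite exprDn_pchar.
have D0 : (0 : G) ^+ (#|F| ^ l) = 0.
  by rewrite expr0n expn_eq0 eqn0Ngt (ltnW (finNzRing_gt1 F)).
rewrite /syndrome (big_morph _ D D0); apply: eq_bigr => i _.
by rewrite exprMn -rmorphXn expF -exprM mulnA.
Qed.

Lemma syndrome_class x i j :
  cyclotomic_class F n j i -> (syndrome x i == 0) = (syndrome x j == 0).
Proof.
have q0 l : (0 < #|F| ^ l)%N by rewrite expn_gt0 (ltnW (finNzRing_gt1 F)).
case=> l [] E.
  by rewrite -syndrome_mod E syndrome_mod syndrome_Frobenius expf_eq0 q0.
by rewrite -[in RHS]syndrome_mod -E syndrome_mod syndrome_Frobenius expf_eq0 q0.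
Qed.

Let mk_Xn1 : mk_monic ('X^n - 1 : {poly F}) = 'X^n - 1.
Proof. by rewrite /mk_monic size_XnsubC // ltnS n_gt0 monicXnsubC. Qed.

Lemma syndrome_horner (x : {ffun G -> F}) (c : {poly F}) t : (size c <= n)%N ->
  (forall i : 'I_n, x (beta ^+ i) = c`_i) ->
  syndrome x t = (map_poly emb c).[beta ^+ t].
Proof.
move=> sc xc; rewrite (@horner_coef_wide _ n) ?size_map_poly //.
by apply: eq_bigr => i _; rewrite coef_map xc -exprM mulnC.
Qed.

Lemma horner_in_qpoly (h : {poly F}) t :
  (map_poly emb (in_qpoly ('X^n - 1) h)).[beta ^+ t] = (map_poly emb h).[beta ^+ t].
Proof.
have Xn1 : ('X^n - 1 : {poly F}) \is monic by rewrite monicXnsubC.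
rewrite [in RHS](Pdiv.RingMonic.rdivp_eq Xn1 h) /= mk_Xn1 rmorphD rmorphM /=.
rewrite !rmorphB /= rmorph1 map_polyXn.
rewrite hornerD hornerM hornerD hornerN hornerXn hornerC -exprM mulnC exprM.
by rewrite (prim_expr_order beta_prim) expr1n subrr mulr0 add0r.
Qed.

Lemma size_qpoly (h : {poly %/ ('X^n - 1 : {poly F})}) : (size (h : {poly F}) < n.+1)%N.
Proof.
have <- : size (mk_monic ('X^n - 1 : {poly F})) = n.+1 by rewrite mk_Xn1 size_XnsubC.
exact: size_mk_monic.
Qed.

Lemma in_qpolyK (h : {poly %/ ('X^n - 1 : {poly F})}) : in_qpoly ('X^n - 1) h = h.
Proof. by apply/val_inj/in_qpoly_small; rewrite size_mk_monic. Qed.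

Lemma extended_code_sum x : x \in Chat -> \sum_X x X = 0.
Proof. by rewrite inE sum_labels => /andP[_ /eqP->]; rewrite addNr. Qed.

Lemma extended_code_syndrome x (t : 'I_n) : x \in Chat -> t \in T -> syndrome x t = 0.
Proof.
rewrite !inE => /andP[/exists_inP[c /imsetP[h _ ch] /forallP xc] _] /rootP gt.
rewrite (syndrome_horner t (size_qpoly c)) => [|i]; last exact/eqP.
rewrite ch -(in_qpolyK h) -in_qpolyM horner_in_qpoly rmorphM hornerM.
by rewrite [X in _ * X]gt mulr0.
Qed.

(** Over G, [g] is up to a unit a product of distinct factors X - beta^i with i in [T]. The word
    polynomial vanishes at these roots, so [g] divides it over G, hence over F. *)
Lemma extended_codeP (x : {ffun G -> F}) : \sum_X x X = 0 ->
  (forall t : 'I_n, t \in T -> syndrome x t = 0) -> x \in Chat.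
Proof.
rewrite sum_labels => x0 xT; rewrite inE -addr_eq0 x0 eqxx andbT.
pose c := \poly_(i < n) x (beta ^+ i).
have sc : (size c <= n)%N := size_poly _ _.
have xc (i : 'I_n) : x (beta ^+ i) = c`_i by rewrite coef_poly ltn_ord.
have [h ch] : exists h, c = h * g.
  apply/dvdpP; rewrite -(dvdp_map emb).
  have : map_poly emb g %| \prod_(0 <= i < n) ('X - (beta ^+ i)%:P).
    rewrite (factor_Xn_sub_1 beta_prim).
    by move: g_dvd; rewrite -(dvdp_map emb) rmorphB /= map_polyXn rmorph1.
  case/dvdp_prod_XsubC => ms g_eqp; rewrite (eqp_dvdl _ g_eqp).
  rewrite -(big_map _ predT (fun z => 'X - z%:P)).
  apply: uniq_roots_dvdp; last first.
    rewrite uniq_rootsE map_inj_in_uniq ?mask_uniq ?iota_uniq // => i j.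
    move=> /mem_mask; rewrite mem_index_iota => /andP[_ ilt].
    move=> /mem_mask; rewrite mem_index_iota => /andP[_ jlt] /eqP.
    by rewrite (eq_prim_root_expr beta_prim) !modn_small // => /eqP.
  apply/allP => _ /mapP[i i_ms ->].
  have ilt : (i < n)%N by have := mem_mask i_ms; rewrite mem_index_iota.
  apply/rootP; rewrite -(syndrome_horner i sc xc).
  apply: (xT (Ordinal ilt)); rewrite inE /= (eqp_root g_eqp).
  by rewrite -(big_map _ predT (fun z => 'X - z%:P)) root_prod_XsubC map_f.
apply/exists_inP; exists (in_qpoly ('X^n - 1) c).
  by apply/imsetP; exists (in_qpoly ('X^n - 1) h); rewrite // -in_qpolyM ch.
by apply/forallP => i; rewrite xc in_qpoly_small // mk_Xn1 size_XnsubC // ltnS.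
Qed.

(** The word of [g] itself has no zero syndromes beyond [T], so one codeword suffices to show that
    an exponent lies in [T]. *)
Lemma generator_word : exists2 x, x \in Chat &
  forall t : 'I_n, syndrome x t = 0 -> t \in T.
Proof.
pose c := in_qpoly ('X^n - 1) g.
pose x0 (X : G) : F :=
  if [pick i : 'I_n | beta ^+ i == X] is Some i then (c : {poly F})`_i else 0.
have x0E (i : 'I_n) : x0 (beta ^+ i) = (c : {poly F})`_i.
  rewrite /x0; case: pickP => [j /eqP/beta_expr_inj-> //|/(_ i)].
  by rewrite eqxx.
pose x : {ffun G -> F} :=
  [ffun X => if X == 0 then - \sum_(i < n) x0 (beta ^+ i) else x0 X].
have xE (i : 'I_n) : x (beta ^+ i) = (c : {poly F})`_i.
  by rewrite ffunE (negPf (beta_expr_neq0 i)) x0E.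
exists x => [|t].
  rewrite inE; apply/andP; split.
    apply/exists_inP; exists c; last by apply/forallP => i; rewrite xE.
    by apply/imsetP; exists 1; rewrite ?mul1r.
  rewrite ffunE eqxx; apply/eqP; congr (- _).
  by apply: eq_bigr => i _; rewrite xE x0E.
rewrite (syndrome_horner t (size_qpoly c) xE) horner_in_qpoly inE => /eqP.
by rewrite rootE.
Qed.

End ExtendedCodes.

(** * Affine invariance puts a power of p in the defining set *)

Lemma expf_pchar_inj (G : finFieldType) p v : p \in [pchar G] ->
  injective (fun X : G => X ^+ (p ^ v)).
Proof.
move=> pG b c /eqP; have p_pr := pcharf_prime pG.
rewrite -subr_eq0 -exprNn_pchar -?exprDn_pchar ?pnatX ?pnatE ?pG //.
by rewrite expf_eq0 subr_eq0 => /andP[_ /eqP].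
Qed.

(** The hypothesis says that the polynomial [P] in Y = b^(p^v) vanishes on all of G, as b -> b^(p^v)
    is onto. Its degree is at most u < #|G|, so [P = 0]; the coefficient of Y^(u-1) is u times the
    wanted sum, and u is invertible. *)
Lemma power_sum_of_translates (G : finFieldType) (p v u : nat) (f : G -> G) :
    p \in [pchar G] -> coprime p u -> (u < #|G|)%N ->
    (forall b, \sum_X f X * (X + b) ^+ (p ^ v * u) = 0) ->
  \sum_X f X * X ^+ (p ^ v) = 0.
Proof.
move=> pG p_u u_lt fb; have p_pr := pcharf_prime pG.
have D : {morph (fun y : G => y ^+ (p ^ v)) : y z / y + z}.
  by move=> y z; rewrite exprDn_pchar // pnatX pnatE // pG.
have u0 : (0 < u)%N.
  rewrite lt0n; apply: contraTneq p_u => ->.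
  by rewrite prime_coprime // dvdn0.
pose P : {poly G} := \sum_X f X *: ((X ^+ (p ^ v))%:P + 'X) ^+ u.
have sP : (size P <= u.+1)%N.
  rewrite (leq_trans (size_sum _ _ _)) //; apply/bigmax_leqP => X _.
  rewrite (leq_trans (size_scale_leq _ _)) // addrC.
  by rewrite -[_%:P]opprK -polyCN size_exp_XsubC.
have P0 : P = 0.
  apply: (@roots_geq_poly_eq0 _ _ (enum G)).
  - apply/allP => y _.
    have /codomP[b ->] : y \in codom (fun b : G => b ^+ (p ^ v)).
      exact/injF_onto/expf_pchar_inj.
    rewrite rootE horner_sum -[X in _ == X](fb b); apply/eqP; apply: eq_bigr => X _.
    by rewrite !hornerE [in RHS]exprM D.
  - exact: enum_uniq.
  by rewrite -cardE (leq_trans sP).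
have := congr1 (fun q : {poly G} => q`_u.-1) P0; rewrite coef0 coef_sum.
under eq_bigr => X _.
  rewrite coefZ exprDn coef_sum.
  have lt_u : (u.-1 < u.+1)%N by rewrite ltnS leq_pred.
  rewrite (bigD1 (Ordinal lt_u)) //= big1 => [|i iu]; last first.
    rewrite coefMn -rmorphXn coefCM coefXn -[u.-1]/(val (Ordinal lt_u)) val_eqE.
    by rewrite eq_sym (negPf iu) mulr0 mul0rn.
  rewrite coefMn -rmorphXn coefCM coefXn eqxx mulr1 addr0.
  rewrite (_ : u - u.-1 = 1)%N ?expr1; last by rewrite -[X in (X - _)%N](prednK u0) subSnn.
  rewrite (_ : 'C(u, u.-1) = u); last by rewrite -[X in 'C(X, _)](prednK u0) binSn prednK.
  rewrite mulrnAr.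
  over.
rewrite sumrMnl -mulr_natr => /eqP; rewrite mulf_eq0 => /orP[/eqP //|].
rewrite -(dvdn_pcharf pG) => p_dvd.
by move: p_u; rewrite prime_coprime // p_dvd.
Qed.

Section AffineInvariance.

Variables (F G : finFieldType) (emb : {rmorphism F -> G}) (n : nat).
Variables (beta : G) (g : {poly F}).
Hypothesis beta_prim : n.-primitive_root beta.
Hypothesis cardG : #|G| = n.+1.
Hypothesis g_dvd : g %| 'X^n - 1.

Local Notation T := (defining_set emb n beta g).
Local Notation Chat := (extended_code n beta g).

Hypothesis g_max : maximal_cyclic emb n beta g.
Hypothesis Chat_inv : affine_invariant Chat.
Hypothesis Chat_neq0 : exists2 x, x \in Chat & x != 0.

Lemma extended_code_translate x b : x \in Chat -> [ffun X => x (X - b)] \in Chat.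
Proof.
move=> xC; rewrite -(Chat_inv (- b) (oner_neq0 _)).
by apply/imsetP; exists x => //; apply/ffunP => X; rewrite !ffunE mul1r.
Qed.

(* The defining set is the class of a power of p, so that the syndrome at     *)
(* that power alone decides membership.                                       *)
Lemma extended_code_power_sum p : p \in [pchar F] ->
  exists v, forall x : {ffun G -> F},
    \sum_X x X = 0 -> \sum_X emb (x X) * X ^+ (p ^ v) = 0 -> x \in Chat.
Proof.
move=> pF; have p_pr := pcharf_prime pF.
have pG : p \in [pchar G] by rewrite (fmorph_pchar emb).
have [j Tj] := g_max.
have jT : j \in T by apply/Tj; exists 0%N; left; rewrite expn0 muln1.
(* If j = 0, the coordinates at nonzero labels sum to 0, and so do all coordinates; thus every word
   vanishes at label 0, and after translation everywhere, against [Chat_neq0]. *)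
have [j0 | j_gt0] := posnP j.
  have [x xC] := Chat_neq0.
  case/negP; apply/eqP/ffunP => X; rewrite [RHS]ffunE.
  have := extended_code_translate (- X) xC; set y := finfun _ => yC.
  have -> : x X = y 0 by rewrite ffunE opprK add0r.
  apply: (fmorph_inj emb); rewrite rmorph0.
  have := congr1 emb (extended_code_sum beta_prim cardG yC).
  rewrite (sum_labels beta_prim cardG) rmorphD rmorph0 rmorph_sum /=.
  rewrite (_ : \sum_i _ = syndrome emb n beta y j) ; last first.
    by apply: eq_bigr => i _; rewrite j0 muln0 expr0 mulr1.
  by rewrite (extended_code_syndrome beta_prim yC jT) addr0.
have [u p_u ju] := pfactor_coprime p_pr j_gt0.
set v := logn p j in ju; exists v => x x0 xv.
have u_gt0 : (0 < u)%N by move: j_gt0; rewrite ju muln_gt0 => /andP[].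
have pv_lt : (p ^ v < n)%N by apply: leq_ltn_trans (ltn_ord j); rewrite ju leq_pmull.
have pv_gt0 : (0 < p ^ v)%N by rewrite expn_gt0 prime_gt0.
(* The translates of the generator word have zero syndrome at j = u p^v, so its own syndrome at p^v
   vanishes. *)
have vT : Ordinal pv_lt \in T.
  have [w wC] := generator_word emb g beta_prim; apply => /=.
  rewrite (syndrome_power_sum emb beta_prim cardG) //.
  apply: (power_sum_of_translates (u := u)) => // [|b].
    rewrite cardG ltnS ltnW // (leq_ltn_trans _ (ltn_ord j)) // ju leq_pmulr //.
  have := extended_code_syndrome beta_prim (extended_code_translate b wC) jT.
  rewrite (syndrome_power_sum emb beta_prim cardG) // (reindex_inj (addIr b)) /=.
  by rewrite ju mulnC; under eq_bigr do rewrite ffunE addrK.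
apply: (extended_codeP (emb := emb) beta_prim cardG) => // t /Tj tj.
apply/eqP; rewrite (syndrome_class emb beta_prim _ tj).
rewrite -(syndrome_class emb beta_prim _ ((Tj _).1 vT)) /=.
by rewrite (syndrome_power_sum emb beta_prim cardG) // xv.
Qed.

End AffineInvariance.

(** * The numerical condition and the final assembly *)

(** Either q >= 4, so that q-1 alone exceeds 2, or r = 1 and p <= 3, in which case s = m > 2. *)
Lemma degree_bound p r m : prime p -> (1 <= r)%N -> (0 < m)%N -> (r %| m)%N ->
    (3 < p)%N \/ (2 < m)%N \/ r <> 1%N ->
  (2 < m %/ r * (p ^ r).-1)%N.
Proof.
move=> p_pr r_gt0 m_gt0 r_m cond.
have p_gt1 := prime_gt1 p_pr.
have s_gt0 : (0 < m %/ r)%N by rewrite divn_gt0 // dvdn_leq.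
have [pr4|pr4] := leqP 4 (p ^ r).
  by apply: leq_trans (leq_pmull _ s_gt0); rewrite -ltnS prednK // ltnW // ltnW // ltnW.
have r1 : r = 1%N.
  apply/eqP; rewrite eqn_leq r_gt0 andbT leqNgt; apply: contraTN pr4 => r2.
  by rewrite -leqNgt (@leq_trans (2 ^ r)) ?leq_exp2r // (@leq_exp2l 2 2).
move: pr4 cond; rewrite r1 divn1 expn1 => p4 [|[m3|//]]; first by rewrite leqNgt p4.
by apply: leq_trans m3 _; rewrite leq_pmulr // -ltnS prednK // ltnW.
Qed.

Theorem theorem6 (R : realType) (p r m : nat)
    (F G : finFieldType) (emb : {rmorphism F -> G})
    (beta : G) (g : {poly F}) (d_A : nat) :
  prime p -> (1 <= r)%N -> (0 < m)%N -> (r %| m)%N ->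
  (3 < p)%N \/ (2 < m)%N \/ r <> 1%N ->
  #|F| = (p ^ r)%N -> #|G| = (p ^ m)%N ->
  (p ^ m - 1)%N.-primitive_root beta ->
  g %| 'X^(p ^ m - 1) - 1 ->
  maximal_cyclic emb (p ^ m - 1) beta g ->
  affine_invariant (extended_code (p ^ m - 1) beta g) ->
  minimum_distance (extended_code (p ^ m - 1) beta g) d_A ->
  exists (d_Q : nat) (U : {vspace nqudits R F (p ^ m)}),
    quantum_code (p ^ m - 2 - 2 * (m %/ r)) d_Q U /\
    (d_A <= d_Q <= m %/ r + 2)%N.
Proof.
move=> p_pr r_gt0 m_gt0 r_m cond cardF cardG beta_prim g_dvd g_max Chat_inv.
case=> [[x [y [xC yC xy _]]] d_min].
have cardG1 : #|G| = (p ^ m - 1).+1 by rewrite cardG subn1 prednK ?expn_gt0 ?prime_gt0.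
have cardGF : #|G| = (#|F| ^ (m %/ r))%N.
  by rewrite cardG cardF -expnM mulnC divnK.
have sF : (2 < m %/ r * #|F|.-1)%N.
  by rewrite cardF; apply: degree_bound.
have pF := card_finPcharP cardF p_pr.
have Chat_neq0 : exists2 w, w \in extended_code (p ^ m - 1) beta g & w != 0.
  have [y0|y0] := eqVneq y 0; last by exists y.
  by exists x => //; rewrite -y0.
have [v Chat_mem] :=
  extended_code_power_sum beta_prim cardG1 g_dvd g_max Chat_inv Chat_neq0 pF.
have pG : p \in [pchar G] by rewrite (fmorph_pchar emb).
have [e [crd crdK combK]] := field_basis emb cardGF.
pose label (i : 'I_(p ^ m)) : G := enum_val (cast_ord (esym cardG) i).
pose index_of X : 'I_(p ^ m) := cast_ord cardG (enum_rank X).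
have labelK : cancel label index_of.
  by move=> i; rewrite /label /index_of enum_valK cast_ordKV.
have index_ofK : cancel index_of label.
  by move=> X; rewrite /label /index_of cast_ordK enum_rankK.
have label_bij : bijective label by exists index_of.
have Frob_bij : bijective (fun X : G => X ^+ (p ^ v)).
  exact/injF_bij/expf_pchar_inj.
(* Taking the coordinates of X^(p^v) rather than of X turns the power sum of exponent p^v into
   equations linear in the coordinates. *)
pose tau i := crd (label i ^+ (p ^ v)).
have tau_bij : bijective tau.
  apply: (bij_comp (f := crd)); first exact: Bijective combK crdK.
  exact: bij_comp Frob_bij label_bij.
pose H := affine_mx tau.
have kernel_mem (w : {ffun G -> F}) :
    (\row_i w (label i)) *m H^T = 0 -> w \in extended_code (p ^ m - 1) beta g.
  move=> wH.
  have wE k : \sum_X w X * affine_monomial k (crd (X ^+ (p ^ v))) = 0.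
    have := congr1 (fun A : 'rV_ _ => A 0 k) wH; rewrite !mxE => w0.
    rewrite -[RHS]w0 [LHS](reindex label) /=; last exact: onW_bij.
    by apply: eq_bigr => i _; rewrite !mxE.
  apply: Chat_mem.
    rewrite -[RHS](wE ord0); apply: eq_bigr => X _.
    by rewrite /affine_monomial unlift_none mulr1.
  under eq_bigr => X _ do rewrite -(combK (X ^+ (p ^ v))) mulr_sumr.
  rewrite exchange_big big1 // => k _.
  transitivity (emb (\sum_X w X * crd (X ^+ (p ^ v)) k) * e k).
    by rewrite rmorph_sum mulr_suml; apply: eq_bigr => X _; rewrite rmorphM mulrA.
  rewrite -[X in emb X * _](_ : \sum_X w X *
    affine_monomial (lift ord0 k) (crd (X ^+ (p ^ v))) = _).
    by rewrite wE rmorph0 mul0r.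
  by apply: eq_bigr => X _; rewrite /affine_monomial liftK.
have H_free : row_free H := affine_mx_free tau_bij.
have H_so : H *m H^T = 0 := affine_mx_self_orthogonal tau_bij sF.
have d_H (z : 'rV[F]_(p ^ m)) : z *m H^T = 0 -> z != 0 -> (d_A <= row_weight z)%N.
  move=> zH z0; pose w : {ffun G -> F} := [ffun X => z 0 (index_of X)].
  have wz : \row_i w (label i) = z by apply/rowP => i; rewrite !mxE ffunE labelK.
  have wC : w \in extended_code (p ^ m - 1) beta g by apply: kernel_mem; rewrite wz.
  have oC : 0 \in extended_code (p ^ m - 1) beta g.
    apply: kernel_mem; rewrite (_ : \row_i _ = 0) ?mul0mx //.
    by apply/rowP => i; rewrite !mxE ffunE.
  have w0 : w != 0.
    by apply: contraNneq z0 => w0; rewrite -wz w0; apply/eqP/rowP => i;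
      rewrite !mxE ffunE.
  apply: leq_trans (d_min _ _ wC oC w0) _.
  rewrite /hamming_dist /row_weight -(card_imset _ (bij_inj label_bij)).
  apply/subset_leq_card/fintype.subsetP => X; rewrite inE !ffunE => zX.
  by rewrite -(index_ofK X) imset_f // inE.
have [d_Q [U [U_code d_bounds]]] := css_code R (ltn0Sn _) H_free H_so d_H.
(* With k = s + 1 rows, k + 1 = s + 2 and N - 2k = N - 2 - 2s. *)
exists d_Q, U; rewrite addn2 d_bounds; split=> //.
by move: U_code; rewrite mulnSr addnC subnDA.
Qed.
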